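(* Let $T>0$. Then $$\sup_{h>0}\ \sup_{\mathbf{u}^h(0)\in L^2(\mathbb{T}_h)}\ \frac{\|\mathbf{u}^h\|_{L^4(0,T;L^4(\mathbb{T}_h))}}{\|\mathbf{u}^h(0)\|_{L^2(\mathbb{T}_h)}}=\infty,$$ where $\mathbf{u}^h$ is the solution of the conservative semidiscrete scheme $$i\frac{d u^h_j}{dt}+\frac{u^h_{j+1}-2u^h_j+u^h_{j-1}}{h^2}=0,\quad t>0,\ j=0,\dots,N,$$ with the periodicity conventions $u^h_{-1}=u^h_N$ and $u^h_{N+1}=u^h_0$, and with $\mathbf{u}^h(0)$ as initial datum. Here $h$ ranges over the mesh sizes $h=1/(N+1)$ with $N$ an even positive integer, and the inner supremum is taken over nonzero initial data.
   Context: $N$ denotes an even positive integer and $h=1/(N+1)$ is the mesh size; thus $h$ always ranges over the values $1/(N+1)$, $N$ even positive. For $1\le p<\infty$, $L^p(\mathbb{T}_h)$ is the space of complex vectors $\mathbf{u}=(u_0,\dots,u_N)$ endowed with the norm $\|\mathbf{u}\|_{L^p(\mathbb{T}_h)}^p=h\sum_{j=0}^N|u_j|^p$. For a time-dependent vector $\mathbf{u}^h(t)=(u^h_j(t))_{j=0}^N$, $\|\mathbf{u}^h\|_{L^4(0,T;L^4(\mathbb{T}_h))}=\big(\int_0^T\|\mathbf{u}^h(t)\|_{L^4(\mathbb{T}_h)}^4\,dt\big)^{1/4}$. *)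

(* Defs.v *)
From Stdlib Require Import Reals Arith.
From Coquelicot Require Import Coquelicot.
Open Scope R_scope.

Definition mesh (N : nat) : R := / INR (N + 1).

(* [Rpower 0 p] is 1 in the standard library, hence the case split at 0. *)
Definition rpow (x p : R) : R :=
  if Req_EM_T x 0 then 0 else Rpower x p.

(* A vector (u_0, ..., u_N) is represented by a function [nat -> C] of which
   only the values at 0, ..., N are ever used. *)

Definition Lp_norm (N : nat) (p : R) (u : nat -> C) : R :=
  rpow (mesh N * sum_f_R0 (fun j => rpow (Cmod (u j)) p) N) (/ p).

Definition LpLp_norm (N : nat) (p T : R) (u : R -> nat -> C) : R :=
  rpow (RInt (fun t => rpow (Lp_norm N p (u t)) p) 0 T) (/ p).

Definition nonzero_vec (N : nat) (u : nat -> C) : Prop :=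
  exists j, (j <= N)%nat /\ u j <> RtoC 0.

(* u_{j+1} and u_{j-1}, with u_{N+1} = u_0 and u_{-1} = u_N. *)
Definition u_next (N : nat) (u : nat -> C) (j : nat) : C :=
  if Nat.eqb j N then u 0%nat else u (S j).

Definition u_prev (N : nat) (u : nat -> C) (j : nat) : C :=
  match j with
  | O => u N
  | S k => u k
  end.

Definition discrete_laplacian (N : nat) (u : nat -> C) (j : nat) : C :=
  ((u_next N u j - 2 * u j + u_prev N u j) / (RtoC (mesh N * mesh N)))%C.

(* The equation is imposed for t > 0 only, so attaining the initial datum also
   requires right-continuity at t = 0; values at t < 0 are irrelevant. *)
Definition is_solution (N : nat) (u0 : nat -> C) (u : R -> nat -> C) : Prop :=
  (forall j, (j <= N)%nat ->
     u 0 j = u0 j /\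
     filterlim (fun t => u t j) (at_right 0) (locally (u0 j))) /\
  (forall t j, 0 < t -> (j <= N)%nat ->
     exists v : C,
       @is_derive R_AbsRing C_R_NormedModule (fun s => u s j) t v /\
       (Ci * v + discrete_laplacian N (u t) j)%C = RtoC 0).

(* Supremum of [f] over [P], in the extended reals. *)
Definition sup_over {A : Type} (P : A -> Prop) (f : A -> Rbar) : Rbar :=
  Rbar_lub (fun y => exists a, P a /\ y = f a).

Definition strichartz_ratio (N : nat) (T : R) (u0 : nat -> C)
    (u : R -> nat -> C) : R :=
  LpLp_norm N 4 T u / Lp_norm N 2 u0.

(* Main.v *)
Require Import Defs.
From Stdlib Require Import Reals Arith Lra Lia.
From Coquelicot Require Import Coquelicot.
Open Scope R_scope.

(** The frequency [q] on the grid of step [h = 1/(N+1)] evolves with pulsation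
    [2 (1 - cos k) / h^2], where [k = 2 pi q h].  Unlike the continuous symbol,
    this one has an inflection point, at [k = pi/2]: there the second
    derivative, which is what disperses a wave packet, vanishes.

    Fix a number [R] of consecutive frequencies and place them next to
    [k = pi/2]; this is possible with [N = 4 k0], where [pi/2] corresponds to
    the frequency [k0 + 1/4].  The solution with unit coefficients is then
    [sum_a exp(i (c + a x + delta_a))], where [x] is the position seen from a
    frame moving at the group velocity and [delta_a] comes from the terms of
    order three and more of the symbol.  One finds [delta_a = O(T R^3 h)]
    ([wave_phase_inflection]), so for [R] fixed and [h] small the solution is,
    up to time [T], a transported Dirichlet kernel that keeps its shape
    ([wave_packet_pow4_ge]).

    The squared modulus of this profile is the Fejer kernel [F], of mean [R],
    while the mean of [F^2] is [R (2 R^2 + 1) / 3]: it counts the solutions of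
    [a + b = c + d] with all four variables among [R] consecutive integers.
    These means over the continuous circle are also the means over the grid,
    since the degrees are smaller than the number of points
    ([grid_avg_fejer], [grid_avg_fejer_sqr]).  Hence the fourth power of the
    ratio is at least [(2/3 T R^3) / R^2], which is unbounded as [R] grows. *)

(** * Real powers *)

Lemma rpow_ge_0 x p : 0 <= rpow x p.
Proof.
unfold rpow; destruct (Req_EM_T x 0); [lra|].
left; apply exp_pos.
Qed.

Lemma rpow_INR x n : 0 <= x -> (0 < n)%nat -> rpow x (INR n) = x ^ n.
Proof.
intros Hx Hn; unfold rpow; destruct (Req_EM_T x 0) as [->|Hx0].
- now rewrite pow_i.
- apply Rpower_pow; lra.
Qed.

Lemma rpow_rpow_inv x p : 0 <= x -> p <> 0 -> rpow (rpow x (/ p)) p = x.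
Proof.
intros Hx Hp; unfold rpow at 2; destruct (Req_EM_T x 0) as [->|Hx0].
- unfold rpow; destruct (Req_EM_T 0 0); lra.
- assert (Hpos : 0 < Rpower x (/ p)) by apply exp_pos.
  unfold rpow; destruct (Req_EM_T (Rpower x (/ p)) 0); [lra|].
  rewrite Rpower_mult, Rinv_l, Rpower_1; lra.
Qed.

Lemma rpow_root_pow x n :
  0 <= x -> (0 < n)%nat -> rpow x (/ INR n) ^ n = x.
Proof.
intros Hx Hn.
rewrite <- rpow_INR; [|apply rpow_ge_0|exact Hn].
apply rpow_rpow_inv; [exact Hx|]. apply not_0_INR; lia.
Qed.

(** * Averages over the grid *)

Definition grid_step (N : nat) : R := 2 * PI * mesh N.

(** The offset [s] is there because the profile is sampled on a grid that is
    displaced as it travels. *)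
Definition grid_avg (N : nat) (s : R) (f : R -> R) : R :=
  mesh N * sum_f_R0 (fun j => f (grid_step N * INR j + s)) N.

Lemma mesh_pos N : 0 < mesh N.
Proof. apply Rinv_0_lt_compat, lt_0_INR; lia. Qed.

Lemma mesh_inv N : mesh N * INR (N + 1) = 1.
Proof. unfold mesh; apply Rinv_l, not_0_INR; lia. Qed.

Lemma grid_avg_ext N s f g : (forall x, f x = g x) -> grid_avg N s f = grid_avg N s g.
Proof. intros H; unfold grid_avg; f_equal; apply sum_eq; auto. Qed.

Lemma grid_avg_plus N s f g :
  grid_avg N s (fun x => f x + g x) = grid_avg N s f + grid_avg N s g.
Proof. unfold grid_avg; rewrite sum_plus; ring. Qed.

Lemma grid_avg_scal N s c f :
  grid_avg N s (fun x => c * f x) = c * grid_avg N s f.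
Proof.
unfold grid_avg.
rewrite (sum_eq _ (fun j => f (grid_step N * INR j + s) * c)) by (intros; ring).
rewrite <- scal_sum; ring.
Qed.

Lemma grid_avg_const N s c : grid_avg N s (fun _ => c) = c.
Proof.
unfold grid_avg; rewrite sum_cte, <- Nat.add_1_r.
rewrite (Rmult_comm c), <- Rmult_assoc, mesh_inv; ring.
Qed.

(** Multiplying by [2 sin (a/2)] makes the sum telescope. *)
Lemma sum_cos_arith a b n :
  2 * sin (a / 2) * sum_f_R0 (fun j => cos (a * INR j + b)) n =
  sin (a * (INR n + / 2) + b) - sin (b - a / 2).
Proof.
assert (E : forall y, 2 * sin (a / 2) * cos y = sin (y + a / 2) - sin (y - a / 2)).
{ intros y; rewrite sin_plus, sin_minus; ring. }
induction n as [|n IH].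
- simpl sum_f_R0; rewrite E; simpl INR.
  replace (a * 0 + b + a / 2) with (a * (0 + / 2) + b) by field.
  now replace (a * 0 + b) with b by ring.
- rewrite tech5, Rmult_plus_distr_l, IH, E, S_INR.
  replace (a * (INR n + 1) + b - a / 2) with (a * (INR n + / 2) + b) by field.
  replace (a * (INR n + 1) + b + a / 2) with (a * (INR n + 1 + / 2) + b) by field.
  ring.
Qed.

(** The arguments of the two boundary sines differ by exactly [r] turns
    around the circle; [r <= N] keeps the factor [sin (pi r / (N+1))] away from 0. *)
Lemma grid_avg_cos N s r :
  (0 < r <= N)%nat -> grid_avg N s (fun x => cos (INR r * x)) = 0.
Proof.
intros Hr; unfold grid_avg.
set (a := INR r * grid_step N).
rewrite (sum_eq _ (fun j => cos (a * INR j + INR r * s)))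
  by (intros; f_equal; unfold a; ring).
assert (Hr0 : 0 < INR r) by (apply lt_0_INR; lia).
assert (Hlt : INR r < INR (N + 1)) by (apply lt_INR; lia).
assert (Hm := mesh_pos N); assert (Hmi := mesh_inv N).
assert (Hpi := PI_RGT_0).
assert (Hsin : 0 < sin (a / 2)).
{ replace (a / 2) with (PI * (INR r * mesh N)) by (unfold a, grid_step; field).
  assert (H1 : 0 < INR r * mesh N) by nra.
  assert (H2 : INR r * mesh N < 1) by nra.
  apply sin_gt_0; nra. }
assert (H := sum_cos_arith a (INR r * s) N).
replace (a * (INR N + / 2) + INR r * s)
  with (INR r * s - a / 2 + 2 * INR r * PI) in H.
2:{ rewrite plus_INR in Hmi; simpl in Hmi.
    replace (INR N) with (INR N + 1 - 1) by ring.
    unfold a, grid_step.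
    transitivity (INR r * s - INR r * (2 * PI * mesh N) / 2
      + 2 * INR r * PI * (mesh N * (INR N + 1))); [rewrite Hmi|]; field. }
rewrite sin_period, Rminus_diag in H.
apply Rmult_integral in H as [H|H]; [lra|]. rewrite H; ring.
Qed.

(** * Dirichlet and Fejer kernels *)

Fixpoint dirichlet (k : nat) (x : R) : R :=
  match k with
  | O => 1
  | S k' => dirichlet k' x + 2 * cos (INR k * x)
  end.

(** [m] times the usual, normalised Fejer kernel: this is the squared modulus of
    a sum of [m] consecutive exponentials, see [exp_sum_arith_Cmod_sqr]. *)
Fixpoint fejer (m : nat) (x : R) : R :=
  match m with
  | O => 0
  | S m' => fejer m' x + dirichlet m' x
  end.

Lemma dirichlet_S k x : dirichlet (S k) x = dirichlet k x + 2 * cos (INR (S k) * x).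
Proof. reflexivity. Qed.

Lemma fejer_S m x : fejer (S m) x = fejer m x + dirichlet m x.
Proof. reflexivity. Qed.

Lemma grid_avg_dirichlet N s k : (k <= N)%nat -> grid_avg N s (dirichlet k) = 1.
Proof.
induction k as [|k IH]; intros Hk.
- exact (grid_avg_const N s 1).
- cbn -[INR]. rewrite grid_avg_plus, grid_avg_scal, grid_avg_cos, IH by lia; ring.
Qed.

Lemma grid_avg_fejer N s m : (m <= N + 1)%nat -> grid_avg N s (fejer m) = INR m.
Proof.
induction m as [|m IH]; intros Hm.
- exact (grid_avg_const N s 0).
- rewrite S_INR; cbn -[INR].
  rewrite grid_avg_plus, grid_avg_dirichlet, IH by lia; ring.
Qed.

(** Orthogonality of the cosines, by the product-to-sum formula; the highest
    frequency [k + l] that it creates must not alias to 0 on the grid. *)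
Lemma grid_avg_cos_dirichlet N s k l :
  (0 < k)%nat -> (k + l <= N)%nat ->
  grid_avg N s (fun x => 2 * cos (INR k * x) * dirichlet l x) =
  if Nat.leb k l then 2 else 0.
Proof.
intros Hk; induction l as [|l IH]; intros Hl.
- rewrite (grid_avg_ext _ _ _ (fun x => 2 * cos (INR k * x)))
    by (intros; simpl; ring).
  rewrite grid_avg_scal, grid_avg_cos by lia.
  destruct k; [lia|]; simpl; ring.
- rewrite (grid_avg_ext _ _ _ (fun x =>
    2 * cos (INR k * x) * dirichlet l x +
    (2 * cos (INR (k - S l + (S l - k)) * x) + 2 * cos (INR (k + S l) * x)))).
  (* One of the truncated differences is 0, so their sum is |k - (l + 1)|. *)
  2:{ intros x; rewrite dirichlet_S.
      assert (E : cos (INR (k - S l + (S l - k)) * x)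
                  = cos (INR k * x - INR (S l) * x)).
      { destruct (le_ge_dec k (S l)) as [H|H].
        - replace (k - S l)%nat with 0%nat by lia.
          rewrite Nat.add_0_l, minus_INR by lia.
          rewrite <- cos_neg; f_equal; ring.
        - replace (S l - k)%nat with 0%nat by lia.
          rewrite Nat.add_0_r, minus_INR by lia.
          f_equal; ring. }
      rewrite E, (plus_INR k (S l)), Rmult_plus_distr_r, cos_plus, cos_minus; ring. }
  rewrite !grid_avg_plus, IH, !grid_avg_scal, (grid_avg_cos _ _ (k + S l)) by lia.
  destruct (Nat.eq_dec k (S l)) as [->|Hne].
  + rewrite (grid_avg_ext _ _ _ (fun _ => 1)).
    2:{ intros; rewrite Nat.sub_diag, Rmult_0_l; apply cos_0. }
    rewrite grid_avg_const, Nat.leb_refl.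
    destruct (Nat.leb_spec (S l) l); [lia|]. ring.
  + rewrite grid_avg_cos by lia.
    destruct (Nat.leb_spec k l), (Nat.leb_spec k (S l)); try lia; ring.
Qed.

Lemma grid_avg_dirichlet_mul N s k l :
  (k <= l)%nat -> (k + l <= N)%nat ->
  grid_avg N s (fun x => dirichlet k x * dirichlet l x) = 1 + 2 * INR k.
Proof.
induction k as [|k IH]; intros Hkl Hl.
- rewrite (grid_avg_ext _ _ _ (dirichlet l)) by (intros; simpl; ring).
  rewrite grid_avg_dirichlet by lia; simpl; ring.
- rewrite (grid_avg_ext _ _ _ (fun x => dirichlet k x * dirichlet l x +
    2 * cos (INR (S k) * x) * dirichlet l x)) by (intros; cbn -[INR]; ring).
  rewrite grid_avg_plus, IH, grid_avg_cos_dirichlet by lia.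
  destruct (Nat.leb_spec (S k) l); [|lia].
  rewrite S_INR; ring.
Qed.

(** For [m <= l] the Dirichlet kernel of order [l] reproduces [fejer m], hence
    the value [fejer m 0 = m^2]. *)
Lemma grid_avg_fejer_dirichlet N s m l :
  (m <= l)%nat -> (m + l <= N)%nat ->
  grid_avg N s (fun x => fejer m x * dirichlet l x) = INR m ^ 2.
Proof.
induction m as [|m IH]; intros Hm Hl.
- rewrite (grid_avg_ext _ _ _ (fun _ => 0)) by (intros; simpl; ring).
  rewrite grid_avg_const; simpl; ring.
- rewrite (grid_avg_ext _ _ _ (fun x => fejer m x * dirichlet l x +
    dirichlet m x * dirichlet l x)) by (intros; cbn -[INR]; ring).
  rewrite grid_avg_plus, IH, grid_avg_dirichlet_mul by lia.
  rewrite S_INR; ring.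
Qed.

(** Since [fejer (m+1) = fejer m + dirichlet m], the mean of the square grows by
    [2 m^2 + (2 m + 1)] at each step; the closed form is the resulting sum. *)
Lemma grid_avg_fejer_sqr N s m :
  (2 * m <= N)%nat ->
  grid_avg N s (fun x => fejer m x ^ 2) = INR m * (2 * INR m ^ 2 + 1) / 3.
Proof.
induction m as [|m IH]; intros Hm.
- rewrite (grid_avg_ext _ _ _ (fun _ => 0)) by (intros; simpl; ring).
  rewrite grid_avg_const; simpl; field.
- rewrite (grid_avg_ext _ _ _ (fun x => fejer m x ^ 2 +
    2 * (fejer m x * dirichlet m x) + dirichlet m x * dirichlet m x))
    by (intros; cbn -[INR]; ring).
  rewrite !grid_avg_plus, grid_avg_scal, IH, grid_avg_fejer_dirichlet,
    grid_avg_dirichlet_mul by lia.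
  rewrite S_INR; field.
Qed.

(** * Sums of unit exponentials *)

Definition exp_sum (M : nat) (phi : nat -> R) : C :=
  (sum_f_R0 (fun a => cos (phi a)) M, sum_f_R0 (fun a => sin (phi a)) M).

(** The Dirichlet kernel with its frequencies listed downwards, which is how they
    arise as the differences between a new frequency and the previous ones. *)
Lemma dirichlet_sum_cos k x :
  1 + 2 * sum_f_R0 (fun a => cos ((INR (S k) - INR a) * x)) k = dirichlet (S k) x.
Proof.
induction k as [|k IH].
- cbn -[INR]. rewrite Rminus_0_r; ring.
- rewrite decomp_sum by lia.
  change (dirichlet (S (S k)) x) with (dirichlet (S k) x + 2 * cos (INR (S (S k)) * x)).
  rewrite <- IH; simpl pred.
  rewrite (sum_eq _ (fun a => cos ((INR (S k) - INR a) * x)))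
    by (intros; f_equal; rewrite !S_INR; ring).
  rewrite Rminus_0_r; ring.
Qed.

Lemma Cmod_sqr z : Cmod z ^ 2 = fst z ^ 2 + snd z ^ 2.
Proof. unfold Cmod; rewrite pow2_sqrt; [reflexivity|nra]. Qed.

Lemma exp_sum_arith_Cmod_sqr M c x :
  Cmod (exp_sum M (fun a => c + INR a * x)) ^ 2 = fejer (S M) x.
Proof.
rewrite Cmod_sqr; unfold exp_sum; simpl fst; simpl snd.
assert (T : forall y, cos y ^ 2 + sin y ^ 2 = 1).
{ intros y; generalize (sin2_cos2 y); unfold Rsqr; lra. }
induction M as [|M IH].
- simpl sum_f_R0; rewrite T; simpl; ring.
- change (fejer (S (S M)) x) with (fejer (S M) x + dirichlet (S M) x).
  rewrite <- IH, <- dirichlet_sum_cos; rewrite !tech5.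
  set (y := c + INR (S M) * x).
  rewrite (sum_eq (fun a => cos ((INR (S M) - INR a) * x))
    (fun a => cos (c + INR a * x) * cos y + sin (c + INR a * x) * sin y)).
  2:{ intros a _. rewrite <- cos_minus, <- cos_neg; f_equal; unfold y; ring. }
  rewrite sum_plus, <- !scal_sum.
  generalize (T y). nra.
Qed.

Lemma fejer_le m x : fejer m x <= INR m ^ 2.
Proof.
assert (D : forall k, dirichlet k x <= 1 + 2 * INR k).
{ induction k as [|k IH]; [simpl; lra|].
  cbn -[INR]; rewrite S_INR.
  generalize (COS_bound (INR k * x + x)); intros.
  replace ((INR k + 1) * x) with (INR k * x + x) by ring. lra. }
induction m as [|m IH]; [simpl; lra|].
cbn -[INR pow]; rewrite S_INR; generalize (D m); nra.
Qed.

Lemma Rabs_cos_minus_le x y : Rabs (cos x - cos y) <= Rabs (x - y).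
Proof.
destruct (MVT_gen cos y x (fun t => - sin t)) as [c [_ ->]].
- intros; apply is_derive_Reals, derivable_pt_lim_cos.
- intros; apply continuity_cos.
- rewrite Rabs_mult, Rabs_Ropp.
  assert (Rabs (sin c) <= 1) by (apply Rabs_le, SIN_bound).
  generalize (Rabs_pos (x - y)); nra.
Qed.

Lemma Rabs_sin_minus_le x y : Rabs (sin x - sin y) <= Rabs (x - y).
Proof.
rewrite <- !cos_shift.
eapply Rle_trans; [apply Rabs_cos_minus_le|].
right; rewrite <- Rabs_Ropp; f_equal; ring.
Qed.

Lemma sum_minus_Rabs_le f g d M :
  (forall a, (a <= M)%nat -> Rabs (f a - g a) <= d) ->
  Rabs (sum_f_R0 f M - sum_f_R0 g M) <= INR (S M) * d.
Proof.
induction M as [|M IH]; intros H.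
- simpl; rewrite Rmult_1_l; auto.
- rewrite S_INR; rewrite !tech5.
  replace (sum_f_R0 f M + f (S M) - (sum_f_R0 g M + g (S M))) with
    (sum_f_R0 f M - sum_f_R0 g M + (f (S M) - g (S M))) by ring.
  eapply Rle_trans; [apply Rabs_triang|].
  assert (H1 := IH ltac:(auto)). assert (H2 := H (S M) ltac:(auto)). lra.
Qed.

Lemma Cmod_le_Rabs z : Cmod z <= Rabs (fst z) + Rabs (snd z).
Proof.
assert (H1 := Rabs_pos (fst z)); assert (H2 := Rabs_pos (snd z)).
apply Rsqr_incr_0; [|apply Cmod_ge_0|lra].
unfold Rsqr; generalize (Cmod_sqr z).
rewrite <- (pow2_abs (fst z)), <- (pow2_abs (snd z)); nra.
Qed.

(** The exponential is 1-Lipschitz in each of its two real components. *)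
Lemma exp_sum_Cmod_perturb M phi psi d :
  (forall a, (a <= M)%nat -> Rabs (phi a - psi a) <= d) ->
  Cmod (exp_sum M psi) - 2 * INR (S M) * d <= Cmod (exp_sum M phi).
Proof.
intros H.
assert (E : exp_sum M psi = (exp_sum M phi + (exp_sum M psi - exp_sum M phi))%C) by ring.
assert (T := Cmod_triangle (exp_sum M phi) (exp_sum M psi - exp_sum M phi)).
rewrite <- E in T.
assert (B := Cmod_le_Rabs (exp_sum M psi - exp_sum M phi)%C).
unfold exp_sum in B at 2 3; simpl fst in B; simpl snd in B.
assert (Hc : Rabs (sum_f_R0 (fun a => cos (psi a)) M + - sum_f_R0 (fun a => cos (phi a)) M)
   <= INR (S M) * d).
{ apply sum_minus_Rabs_le; intros a Ha; eapply Rle_trans; [apply Rabs_cos_minus_le|].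
  rewrite Rabs_minus_sym; auto. }
assert (Hs : Rabs (sum_f_R0 (fun a => sin (psi a)) M + - sum_f_R0 (fun a => sin (phi a)) M)
   <= INR (S M) * d).
{ apply sum_minus_Rabs_le; intros a Ha; eapply Rle_trans; [apply Rabs_sin_minus_le|].
  rewrite Rabs_minus_sym; auto. }
unfold exp_sum in *; simpl in B. lra.
Qed.

(** * Exact solutions *)

Definition dispersion (N q : nat) : R :=
  2 * (1 - cos (grid_step N * INR q)) / (mesh N * mesh N).

(** The position [x] is real rather than an index of the grid, so that the two
    neighbours of a point are reached as [x + 1] and [x - 1] without treating
    the ends separately. *)
Definition wave_phase (N : nat) (p : nat -> nat) (t x : R) (a : nat) : R :=
  grid_step N * INR (p a) * x - dispersion N (p a) * t.

Definition wave_packet (N : nat) (p : nat -> nat) (M : nat) (t : R) (j : nat) : C :=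
  exp_sum M (wave_phase N p t (INR j)).

Lemma is_derive_C_pair (f g : R -> R) t lf lg :
  is_derive f t lf -> is_derive g t lg ->
  @is_derive R_AbsRing C_R_NormedModule (fun s => (f s, g s)) t (lf, lg).
Proof.
intros Hf Hg.
apply (is_derive_ext (V := C_R_NormedModule)
  (fun s => plus (scal (f s) ((1, 0) : C_R_NormedModule))
                 (scal (g s) ((0, 1) : C_R_NormedModule)))).
- intros s; unfold plus, scal; simpl; unfold prod_plus, prod_scal; simpl.
  unfold scal, plus; simpl; unfold mult; simpl. f_equal; ring.
- replace ((lf, lg) : C) with
    (plus (scal lf ((1, 0) : C_R_NormedModule)) (scal lg ((0, 1) : C_R_NormedModule))).
  + apply (is_derive_plus (V := C_R_NormedModule));
      apply (is_derive_scal_l (V := C_R_NormedModule)); assumption.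
  + unfold plus, scal; simpl; unfold prod_plus, prod_scal; simpl.
    unfold scal, plus; simpl; unfold mult; simpl. f_equal; ring.
Qed.

Lemma is_derive_sum_f_R0 (f : nat -> R -> R) (l : nat -> R) t M :
  (forall a, is_derive (f a) t (l a)) ->
  is_derive (fun s => sum_f_R0 (fun a => f a s) M) t (sum_f_R0 l M).
Proof.
intros H; induction M as [|M IH]; [apply H|].
apply (is_derive_plus (V := R_NormedModule)); [exact IH|apply H].
Qed.

Lemma is_derive_wave_packet N p M j t :
  @is_derive R_AbsRing C_R_NormedModule (fun s => wave_packet N p M s j) t
    (sum_f_R0 (fun a => dispersion N (p a) * sin (wave_phase N p t (INR j) a)) M,
     - sum_f_R0 (fun a => dispersion N (p a) * cos (wave_phase N p t (INR j) a)) M).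
Proof.
unfold wave_packet, exp_sum, wave_phase; apply is_derive_C_pair.
- apply is_derive_sum_f_R0; intros a; auto_derive; [exact I|unfold Rminus; ring].
- replace (- sum_f_R0 (fun a => dispersion N (p a) *
      cos (grid_step N * INR (p a) * INR j - dispersion N (p a) * t)) M)
    with (sum_f_R0 (fun a => - dispersion N (p a) *
      cos (grid_step N * INR (p a) * INR j - dispersion N (p a) * t)) M).
  + apply is_derive_sum_f_R0; intros a; auto_derive; [exact I|unfold Rminus; ring].
  + match goal with |- _ = - ?S => replace (- S) with (-1 * S) by ring end.
    rewrite scal_sum; apply sum_eq; intros; ring.
Qed.

Lemma exp_sum_ext M phi psi :
  (forall a, cos (phi a) = cos (psi a) /\ sin (phi a) = sin (psi a)) ->
  exp_sum M phi = exp_sum M psi.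
Proof.
intros H; unfold exp_sum; f_equal; apply sum_eq; intros; apply H.
Qed.

(** All wave numbers are multiples of [2 pi / (N+1)]; this is what turns the
    wrap-around of the indices into a plain shift. *)
Lemma exp_sum_wave_phase_period N p M t x y :
  x = y + INR (N + 1) -> exp_sum M (wave_phase N p t x) = exp_sum M (wave_phase N p t y).
Proof.
intros ->; apply exp_sum_ext; intros a.
replace (wave_phase N p t (y + INR (N + 1)) a)
  with (wave_phase N p t y a + 2 * INR (p a) * PI).
- now rewrite cos_period, sin_period.
- unfold wave_phase, grid_step.
  transitivity (2 * PI * mesh N * INR (p a) * y - dispersion N (p a) * t
     + 2 * PI * INR (p a) * (mesh N * INR (N + 1))); [rewrite mesh_inv|]; ring.
Qed.

Lemma wave_packet_next N p M t j : (j <= N)%nat ->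
  u_next N (wave_packet N p M t) j = exp_sum M (wave_phase N p t (INR j + 1)).
Proof.
intros Hj; unfold u_next, wave_packet; rewrite <- S_INR.
destruct (Nat.eqb_spec j N) as [->|]; [|reflexivity].
symmetry; apply exp_sum_wave_phase_period.
rewrite Nat.add_1_r; simpl (INR 0); ring.
Qed.

Lemma wave_packet_prev N p M t j :
  u_prev N (wave_packet N p M t) j = exp_sum M (wave_phase N p t (INR j - 1)).
Proof.
unfold u_prev, wave_packet; destruct j as [|j].
- apply exp_sum_wave_phase_period; rewrite plus_INR; simpl; ring.
- rewrite S_INR; f_equal; f_equal; ring.
Qed.

(** Each exponential is an eigenvector of the second difference; [g] stands for
    the real and the imaginary part at once. *)
Lemma sum_second_difference (g : R -> R) N p M t x :
  (forall y k, g (y + k) - 2 * g y + g (y - k) = - (2 * (1 - cos k)) * g y) ->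
  (sum_f_R0 (fun a => g (wave_phase N p t (x + 1) a)) M -
   2 * sum_f_R0 (fun a => g (wave_phase N p t x a)) M +
   sum_f_R0 (fun a => g (wave_phase N p t (x - 1) a)) M) / (mesh N * mesh N) =
  - sum_f_R0 (fun a => dispersion N (p a) * g (wave_phase N p t x a)) M.
Proof.
intros Hg; assert (Hm := mesh_pos N).
assert (E : forall a,
  (g (wave_phase N p t (x + 1) a) - 2 * g (wave_phase N p t x a) +
   g (wave_phase N p t (x - 1) a)) / (mesh N * mesh N) =
  - (dispersion N (p a) * g (wave_phase N p t x a))).
{ intros a; unfold dispersion.
  rewrite <- (Rmult_1_r (- _)).
  replace (wave_phase N p t (x + 1) a) with
    (wave_phase N p t x a + grid_step N * INR (p a)) by (unfold wave_phase; ring).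
  replace (wave_phase N p t (x - 1) a) with
    (wave_phase N p t x a - grid_step N * INR (p a)) by (unfold wave_phase; ring).
  rewrite Hg; field; lra. }
induction M as [|M IH]; [apply E|].
rewrite !tech5, Ropp_plus_distr, <- IH, <- E; field; lra.
Qed.

Lemma wave_packet_solution N p M :
  is_solution N (wave_packet N p M 0) (wave_packet N p M).
Proof.
split.
- intros j Hj; split; [reflexivity|].
  assert (C := ex_derive_continuous (V := C_R_NormedModule) _ 0
    (ex_intro _ _ (is_derive_wave_packet N p M j 0))).
  eapply filterlim_filter_le_1; [|exact C].
  apply filter_le_within; apply locally_filter.
- intros t j Ht Hj; eexists; split; [apply is_derive_wave_packet|].
  unfold discrete_laplacian.
  rewrite wave_packet_next, wave_packet_prev by exact Hj.
  assert (Hm := mesh_pos N).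
  assert (Hc := sum_second_difference cos N p M t (INR j)).
  assert (Hs := sum_second_difference sin N p M t (INR j)).
  assert (D : forall (z : C) r, r <> 0 -> (z / RtoC r)%C = (fst z / r, snd z / r)).
  { intros [x y] r Hr; unfold Cdiv, Cinv, Cmult, RtoC; simpl; f_equal; field; exact Hr. }
  rewrite D by nra.
  unfold wave_packet, exp_sum, Ci, Cmult, Cplus, Cminus, Copp, RtoC; simpl fst; simpl snd.
  f_equal.
  + transitivity (sum_f_R0 (fun a => dispersion N (p a) * cos (wave_phase N p t (INR j) a)) M
      + - sum_f_R0 (fun a => dispersion N (p a) * cos (wave_phase N p t (INR j) a)) M);
      [|ring].
    rewrite <- Hc at 2; [field; lra|].
    intros; rewrite cos_plus, cos_minus; ring.
  + transitivity (sum_f_R0 (fun a => dispersion N (p a) * sin (wave_phase N p t (INR j) a)) M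
      + - sum_f_R0 (fun a => dispersion N (p a) * sin (wave_phase N p t (INR j) a)) M);
      [|ring].
    rewrite <- Hs; [field; lra|].
    intros; rewrite sin_plus, sin_minus; ring.
Qed.

(** * Norms as sums and integrals of powers *)

Lemma Lp_norm_pow N n u : (0 < n)%nat ->
  Lp_norm N (INR n) u ^ n = mesh N * sum_f_R0 (fun j => Cmod (u j) ^ n) N.
Proof.
intros Hn; unfold Lp_norm.
rewrite (sum_eq _ (fun j => Cmod (u j) ^ n))
  by (intros; apply rpow_INR; [apply Cmod_ge_0|exact Hn]).
apply rpow_root_pow; [|exact Hn].
apply Rmult_le_pos; [left; apply mesh_pos|].
apply cond_pos_sum; intros; apply pow_le, Cmod_ge_0.
Qed.

Lemma LpLp_norm_pow N n T u : (0 < n)%nat ->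
  let power_sum t := mesh N * sum_f_R0 (fun j => Cmod (u t j) ^ n) N in
  0 <= RInt power_sum 0 T -> LpLp_norm N (INR n) T u ^ n = RInt power_sum 0 T.
Proof.
intros Hn power_sum Hge; unfold LpLp_norm.
rewrite (RInt_ext _ power_sum).
- apply rpow_root_pow; assumption.
- intros t _; rewrite rpow_INR by (apply rpow_ge_0 || exact Hn).
  now apply Lp_norm_pow.
Qed.

(** The fourth power of the modulus is a polynomial in the real and imaginary
    parts, hence smooth even where the modulus vanishes. *)
Lemma ex_derive_wave_packet_pow4 N p M j t :
  ex_derive (fun s => Cmod (wave_packet N p M s j) ^ 4) t.
Proof.
apply (ex_derive_ext (fun s =>
  (sum_f_R0 (fun a => cos (wave_phase N p s (INR j) a)) M ^ 2 +
   sum_f_R0 (fun a => sin (wave_phase N p s (INR j) a)) M ^ 2) ^ 2)).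
- intros s; replace 4%nat with (2 * 2)%nat by reflexivity.
  now rewrite pow_mult, Cmod_sqr.
- assert (E : forall g : R -> R, (forall y, ex_derive g y) ->
    ex_derive (fun s => sum_f_R0 (fun a => g (wave_phase N p s (INR j) a)) M) t).
  { intros g Hg; eexists; apply is_derive_sum_f_R0; intros a.
    apply Derive_correct, (ex_derive_comp g); [apply Hg|].
    unfold wave_phase; auto_derive; exact I. }
  assert (Hc := E cos ltac:(intros; auto_derive; exact I)).
  assert (Hs := E sin ltac:(intros; auto_derive; exact I)).
  assert (P : forall f g : R -> R, ex_derive f t -> ex_derive g t ->
    ex_derive (fun s => (f s ^ 2 + g s ^ 2) ^ 2) t)
    by (intros; auto_derive; auto).
  exact (P _ _ Hc Hs).
Qed.

Lemma ex_RInt_wave_packet_pow4 N p M T :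
  ex_RInt (fun t => mesh N * sum_f_R0 (fun j => Cmod (wave_packet N p M t j) ^ 4) N) 0 T.
Proof.
apply (ex_RInt_continuous (V := R_CompleteNormedModule)); intros t _.
apply (ex_derive_continuous (V := R_NormedModule)).
apply (ex_derive_scal (fun t => sum_f_R0 (fun j => Cmod (wave_packet N p M t j) ^ 4) N)).
eexists; apply (is_derive_sum_f_R0 (fun j t => Cmod (wave_packet N p M t j) ^ 4)).
intros j; apply Derive_correct, ex_derive_wave_packet_pow4.
Qed.

(** * Packets at the inflection point of the symbol *)

(** Frequencies starting just above [k0 + 1/4], which for [N = 4 k0] is exactly
    the wave number [pi/2]; staying on one side of it keeps the arguments of the
    bound on [y - sin y] nonnegative. *)
Definition inflection_freq (k0 a : nat) : nat := k0 + 1 + a.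

(** Displacement, as an angle, due to the group velocity at [pi/2]. *)
Definition drift (N : nat) (t : R) : R := - 2 * grid_step N / (mesh N * mesh N) * t.

Lemma minus_sin_bound y : 0 <= y <= 4 -> 0 <= y - sin y <= y ^ 3 / 6.
Proof.
intros Hy; split.
- destruct (Req_dec y 0) as [->|]; [rewrite sin_0; lra|].
  generalize (sin_lt_x y ltac:(lra)); lra.
- destruct (pre_sin_bound y 0) as [H _]; try lra.
  unfold sin_approx, sin_term in H; simpl in H. lra.
Qed.

(** With [b] the distance from the wave number to [pi/2], the pulsation is
    [2 (1 + sin b) / h^2].  Replacing [sin b] by [b] leaves a phase that is affine
    in [a], and the error [2 t (b - sin b) / h^2] is at most
    [T b^3 / (3 h^2) = O(h)], because [b = O(h)] and the quadratic term is
    absent. *)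
Lemma wave_phase_inflection k0 M T t x :
  (2 * S M <= 4 * k0)%nat -> 0 <= t <= T ->
  let N := (4 * k0)%nat in
  exists c, forall a, (a <= M)%nat ->
  Rabs (wave_phase N (inflection_freq k0) t x a
        - (c + INR a * (grid_step N * x + drift N t)))
  <= 171 * T * INR (S M) ^ 3 * mesh N.
Proof.
intros HM Ht N.
assert (Hm := mesh_pos N); assert (Hmi := mesh_inv N).
assert (Hpi := PI_RGT_0); assert (Hpi4 := PI_4).
set (h := mesh N) in *; set (r := INR (S M)).
exists (grid_step N * INR (k0 + 1) * x - 2 * t / (h * h)
   - 2 * (grid_step N * (3 / 4)) * t / (h * h)).
intros a Ha.
set (b := grid_step N * (INR a + 3 / 4)).
assert (Hr : INR a + 1 <= r) by (unfold r; rewrite <- S_INR; apply le_INR; lia).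
assert (Ha0 := pos_INR a).
assert (Hb : 0 <= b <= 8 * h * r).
{ unfold b, grid_step; fold h; split; [apply Rmult_le_pos; nra|].
  apply Rle_trans with (2 * 4 * h * (INR a + 3 / 4)); [|nra].
  apply Rmult_le_compat_r; nra. }
assert (Hr2 : 2 * r <= INR (N + 1)).
{ unfold r; change 2 with (INR 2); rewrite <- mult_INR; apply le_INR; unfold N; lia. }
assert (Hb4 : 8 * h * r <= 4) by nra.
(* pi/2 = grid_step * (k0 + 1/4), from h (4 k0 + 1) = 1 *)
assert (Hcos : cos (grid_step N * INR (inflection_freq k0 a)) = - sin b).
{
  replace (grid_step N * INR (inflection_freq k0 a)) with (PI / 2 + b).
  - rewrite cos_plus, cos_PI2, sin_PI2; ring.
  - unfold b, grid_step, inflection_freq; fold h.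
    rewrite !plus_INR; rewrite plus_INR in Hmi; unfold N in Hmi; rewrite mult_INR in Hmi.
    simpl in Hmi |- *.
    transitivity (PI / 2 * (h * ((1 + 1 + 1 + 1) * INR k0 + 1))
       + 2 * PI * h * (INR a + 3 / 4)); [rewrite Hmi|]; field. }
match goal with |- Rabs ?e <= _ =>
  replace e with (2 * t / (h * h) * (b - sin b)) end.
2:{ unfold wave_phase, drift, dispersion; fold h. rewrite Hcos.
    unfold b, inflection_freq; rewrite !plus_INR; simpl INR; field; lra. }
destruct (minus_sin_bound b ltac:(lra)) as [S1 S2].
assert (Hq : 0 <= / (h * h)) by (left; apply Rinv_0_lt_compat; nra).
rewrite Rabs_pos_eq.
2:{ apply Rmult_le_pos; [|exact S1]. unfold Rdiv; apply Rmult_le_pos; lra. }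
apply Rle_trans with (2 * T / (h * h) * ((8 * h * r) ^ 3 / 6)).
- apply Rmult_le_compat; try assumption.
  + unfold Rdiv; apply Rmult_le_pos; lra.
  + unfold Rdiv; apply Rmult_le_compat_r; lra.
  + assert (b ^ 3 <= (8 * h * r) ^ 3) by (apply pow_incr; exact Hb). lra.
(* 171 bounds 512/3, where 512 = 8^3 comes from b <= 8 h r, using pi <= 4. *)
- replace (2 * T / (h * h) * ((8 * h * r) ^ 3 / 6)) with (512 / 3 * (T * r ^ 3 * h))
    by (field; lra).
  assert (0 <= T * r ^ 3 * h).
  { apply Rmult_le_pos; [apply Rmult_le_pos; [lra|apply pow_le; lra]|lra]. }
  lra.
Qed.

(** Convexity of the fourth power. *)
Lemma pow4_tangent_ge u g : 0 <= u -> 0 <= g -> g ^ 4 + 4 * g ^ 3 * (u - g) <= u ^ 4.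
Proof.
intros Hu Hg.
assert (0 <= (u - g) ^ 2 * (u ^ 2 + 2 * (u * g) + 3 * g ^ 2)).
{ apply Rmult_le_pos; [apply pow2_ge_0|].
  generalize (pow2_ge_0 u), (pow2_ge_0 g), (Rmult_le_pos _ _ Hu Hg); lra. }
nra.
Qed.

(** The phase error [d] lowers the modulus by at most [2 r d], where [r] is the
    number of frequencies, and its fourth power by at most [4 r^3 (2 r d)] as the
    profile is at most [r].  This is [1368 T r^7 h], with [1368 = 8 * 171]. *)
Lemma wave_packet_pow4_ge k0 M T t j :
  (2 * S M <= 4 * k0)%nat -> 0 <= t <= T ->
  1368 * T * INR (S M) ^ 7 * mesh (4 * k0) <= 1 ->
  let N := (4 * k0)%nat in
  fejer (S M) (grid_step N * INR j + drift N t) ^ 2 + - 1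
  <= Cmod (wave_packet N (inflection_freq k0) M t j) ^ 4.
Proof.
intros HM Ht Hh N.
destruct (wave_phase_inflection k0 M T t (INR j) HM Ht) as [c Hc]; fold N in Hc.
set (x := grid_step N * INR j + drift N t) in *.
set (d := 171 * T * INR (S M) ^ 3 * mesh N) in *.
assert (P := exp_sum_Cmod_perturb M _ (fun a => c + INR a * x) d Hc).
assert (F := exp_sum_arith_Cmod_sqr M c x).
set (g := Cmod (exp_sum M (fun a => c + INR a * x))) in *.
assert (Hg : 0 <= g) by apply Cmod_ge_0.
assert (U := pow4_tangent_ge _ g (Cmod_ge_0 (wave_packet N (inflection_freq k0) M t j)) Hg).
unfold wave_packet in *.
set (u := Cmod (exp_sum M (wave_phase N (inflection_freq k0) t (INR j)))) in *.
rewrite <- F.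
assert (Hgr : g <= INR (S M)).
{ apply Rsqr_incr_0; [|exact Hg|apply pos_INR].
  generalize (fejer_le (S M) x); rewrite <- F; unfold Rsqr; lra. }
set (r := INR (S M)) in *.
assert (Hg3 : g ^ 3 <= r ^ 3) by (apply pow_incr; lra).
assert (Hr0 : 0 <= r) by lra.
assert (Hd : 0 <= 2 * r * d).
{ unfold d; repeat apply Rmult_le_pos; try lra; try (apply pow_le; lra).
  left; apply mesh_pos. }
assert (Hgd : g ^ 3 * (2 * r * d) <= r ^ 3 * (2 * r * d))
  by (apply Rmult_le_compat_r; assumption).
assert (Hgu : g ^ 3 * (- (2 * r * d)) <= g ^ 3 * (u - g)).
{ apply Rmult_le_compat_l; [apply pow_le, Hg|lra]. }
assert (E : 4 * (r ^ 3 * (2 * r * d)) = 1368 * T * r ^ 7 * mesh N) by (unfold d; ring).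
fold N in Hh.
replace ((g ^ 2) ^ 2) with (g ^ 4) by ring. lra.
Qed.

(** At each time the sum over the grid is at least [r (2 r^2 + 1) / 3 - 1], and
    [r >= 3] lets the term [r / 3] absorb the loss of 1. *)
Lemma wave_packet_LpLp_ge k0 M T :
  0 < T -> (2 * S M <= 4 * k0)%nat -> (2 <= M)%nat ->
  1368 * T * INR (S M) ^ 7 * mesh (4 * k0) <= 1 ->
  2 / 3 * T * INR (S M) ^ 3
  <= LpLp_norm (4 * k0) 4 T (wave_packet (4 * k0) (inflection_freq k0) M) ^ 4.
Proof.
intros HT HM HM2 Hh; set (N := (4 * k0)%nat) in *.
set (r := INR (S M)) in *.
assert (Hr : 3 <= r).
{ unfold r; replace 3 with (INR 3) by (simpl; ring); apply le_INR; lia. }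
set (w := wave_packet N (inflection_freq k0) M).
assert (L : forall t, 0 < t < T -> 2 / 3 * r ^ 3 <=
  mesh N * sum_f_R0 (fun j => Cmod (w t j) ^ 4) N).
{ intros t Ht.
  apply Rle_trans with
    (grid_avg N (drift N t) (fun x => fejer (S M) x ^ 2 + - 1)).
  - rewrite grid_avg_plus, grid_avg_const, grid_avg_fejer_sqr by lia.
    fold r; nra.
  - unfold grid_avg; apply Rmult_le_compat_l; [left; apply mesh_pos|].
    apply sum_Rle; intros j _.
    apply (wave_packet_pow4_ge k0 M T t j); [exact HM|lra|exact Hh]. }
assert (I : RInt (fun _ => 2 / 3 * r ^ 3) 0 T <=
  RInt (fun t => mesh N * sum_f_R0 (fun j => Cmod (w t j) ^ 4) N) 0 T).
{ apply RInt_le; [lra|apply ex_RInt_const|apply ex_RInt_wave_packet_pow4|exact L]. }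
rewrite RInt_const in I; unfold scal in I; simpl in I; unfold mult in I; simpl in I.
replace 4 with (INR 4) by (simpl; ring).
assert (0 <= T * r ^ 3) by (apply Rmult_le_pos; [lra|apply pow_le; lra]).
rewrite LpLp_norm_pow; [|lia|]; fold w in I |- *; simpl in *; lra.
Qed.

Lemma wave_packet_L2 k0 M :
  (S M <= 4 * k0)%nat ->
  Lp_norm (4 * k0) 2 (wave_packet (4 * k0) (inflection_freq k0) M 0) ^ 2 = INR (S M).
Proof.
intros HM; set (N := (4 * k0)%nat) in *.
replace 2 with (INR 2) by (simpl; ring).
rewrite Lp_norm_pow by lia.
rewrite <- (grid_avg_fejer N 0 (S M)) by lia.
unfold grid_avg; f_equal; apply sum_eq; intros j _.
rewrite <- (exp_sum_arith_Cmod_sqr M (grid_step N * INR (k0 + 1) * INR j)).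
unfold wave_packet; do 2 f_equal.
apply exp_sum_ext; intros a.
replace (wave_phase N (inflection_freq k0) 0 (INR j) a) with
  (grid_step N * INR (k0 + 1) * INR j + INR a * (grid_step N * INR j + 0)); [easy|].
unfold wave_phase, inflection_freq; rewrite (plus_INR (k0 + 1)); ring.
Qed.

Lemma wave_packet_nonzero N p M : nonzero_vec N (wave_packet N p M 0).
Proof.
exists 0%nat; split; [lia|]; intros H; apply (f_equal fst) in H.
unfold wave_packet, exp_sum in H; simpl fst in H.
rewrite (sum_eq _ (fun _ => 1)), sum_cte, Rmult_1_l in H.
- revert H; apply not_0_INR; lia.
- intros a _; rewrite <- cos_0; f_equal; unfold wave_phase; simpl; ring.
Qed.

Lemma pow4_le_inv x y : 0 <= y -> x ^ 4 <= y ^ 4 -> x <= y.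
Proof.
intros Hy H; apply Rnot_lt_le; intros Hlt.
assert (y ^ 2 < x ^ 2) by nra. assert (0 <= y ^ 2) by nra.
nra.
Qed.

(** * Unboundedness of the ratio *)

(** The number of frequencies is chosen first, as a function of the target [B],
    and only then the mesh, fine enough for that number. *)
Lemma strichartz_ratio_unbounded T B :
  0 < T -> 0 < B ->
  exists k0 M, (0 < k0)%nat /\
  B <= strichartz_ratio (4 * k0) T (wave_packet (4 * k0) (inflection_freq k0) M 0)
         (wave_packet (4 * k0) (inflection_freq k0) M).
Proof.
intros HT HB.
destruct (INR_unbounded (2 * B ^ 4 / T)) as [M0 HM0].
set (M := (M0 + 2)%nat).
destruct (INR_unbounded (1368 * T * INR (S M) ^ 7)) as [k1 Hk1].
set (k0 := (k1 + S M)%nat); exists k0, M; split; [lia|].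
set (N := (4 * k0)%nat); set (w := wave_packet N (inflection_freq k0) M).
assert (Hm := mesh_pos N); assert (Hmi := mesh_inv N).
assert (HkN : INR k1 <= INR (N + 1)) by (apply le_INR; unfold N, k0; lia).
assert (L4 : 2 / 3 * T * INR (S M) ^ 3 <= LpLp_norm N 4 T w ^ 4).
{ apply wave_packet_LpLp_ge; [exact HT|lia|lia|].
  fold N; rewrite <- Hmi, (Rmult_comm (mesh N)).
  apply Rmult_le_compat_r; lra. }
assert (L2 : Lp_norm N 2 (w 0) ^ 2 = INR (S M)) by (apply wave_packet_L2; lia).
assert (Hr : 2 * B ^ 4 / T <= INR (S M)).
{ apply Rlt_le, Rlt_le_trans with (1 := HM0), le_INR; unfold M; lia. }
assert (Hr0 : 0 < INR (S M)) by (apply lt_0_INR; lia).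
set (r := INR (S M)) in *.
assert (P4 : 0 <= LpLp_norm N 4 T w) by apply rpow_ge_0.
assert (P2 : 0 <= Lp_norm N 2 (w 0)) by apply rpow_ge_0.
unfold strichartz_ratio; fold w.
set (x := LpLp_norm N 4 T w) in *; set (y := Lp_norm N 2 (w 0)) in *.
assert (Hy : 0 < y) by nra.
apply Rmult_le_reg_r with y; [exact Hy|].
replace (x / y * y) with x by (field; lra).
apply pow4_le_inv; [exact P4|].
replace ((B * y) ^ 4) with (B ^ 4 * (y ^ 2) ^ 2) by ring; rewrite L2.
assert (HB4 : 2 * B ^ 4 <= T * r).
{ apply Rmult_le_reg_r with (/ T); [now apply Rinv_0_lt_compat|].
  replace (T * r * / T) with r by (field; lra). exact Hr. }
assert (HB5 : 2 * B ^ 4 * r ^ 2 <= T * r * r ^ 2)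
  by (apply Rmult_le_compat_r; [apply pow2_ge_0|exact HB4]).
assert (0 <= T * r ^ 3) by (apply Rmult_le_pos; [lra|apply pow_le; lra]).
lra.
Qed.

Lemma sup_over_ub {A : Type} (P : A -> Prop) (f : A -> Rbar) a :
  P a -> Rbar_le (f a) (sup_over P f).
Proof.
intros Ha; unfold sup_over, Rbar_lub.
destruct (Rbar_ex_lub _) as [l Hl]; simpl.
apply Hl; now exists a.
Qed.

Lemma Rbar_unbounded_p_infty (l : Rbar) :
  (forall B : R, 0 < B -> Rbar_le B l) -> l = p_infty.
Proof.
intros H; destruct l as [l| |]; [|reflexivity|].
- specialize (H (Rabs l + 1)); simpl in H.
  generalize (Rabs_pos l), (Rle_abs l); lra.
- now specialize (H 1 Rlt_0_1).
Qed.

Theorem theorem2p1 (T : R) (HT : 0 < T) :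
  sup_over (fun N : nat => (0 < N)%nat /\ Nat.Even N)
    (fun N : nat =>
       sup_over
         (fun d : (nat -> C) * (R -> nat -> C) =>
            nonzero_vec N (fst d) /\ is_solution N (fst d) (snd d))
         (fun d => Finite (strichartz_ratio N T (fst d) (snd d))))
  = p_infty.
Proof.
apply Rbar_unbounded_p_infty; intros B HB.
destruct (strichartz_ratio_unbounded T B HT HB) as (k0 & M & Hk0 & Hratio).
pose (N := (4 * k0)%nat); pose (w := wave_packet N (inflection_freq k0) M).
eapply Rbar_le_trans; [|apply (sup_over_ub _ _ N)].
- eapply Rbar_le_trans; [|apply (sup_over_ub _ _ (w 0, w))].
  + exact Hratio.
  + split; [apply wave_packet_nonzero|apply wave_packet_solution].
- split; [lia|exists (2 * k0)%nat; lia].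
Qed.
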